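(* Let $(\Omega,\mathcal A,\mathbb P)$ be a probability space, let $(\mathcal G_n)_{n\ge0}$ be a filtration, and let $Y,Y_0,Y_1,\dots$ be non-negative random variables defined on this probability space. Suppose that $Y$ is measurable with respect to $\mathcal G_\infty=\bigvee_{k\ge0}\mathcal G_k$. Suppose that for every $\lambda\in\mathbb Q\cap(0,\infty)$, $$\mathbb E\big[e^{-\lambda Y_n}\,\big|\,\mathcal G_n\big]\underset{n\to\infty}{\longrightarrow}e^{-\lambda Y}\quad\text{almost surely}.$$ Then $Y_n$ converges in probability to $Y$ as $n\to\infty$.
   Context: Random variables are real-valued (finite). No adaptedness of $(Y_n)$ to $(\mathcal G_n)$ is assumed. *)

(* Defs.v *)
From HB Require Import structures.
From mathcomp Require Import all_boot all_order all_algebra.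
From mathcomp Require Import all_classical all_reals all_analysis.

Set Implicit Arguments.
Unset Strict Implicit.
Unset Printing Implicit Defensive.

Import Order.TTheory GRing.Theory Num.Theory.
Import numFieldNormedType.Exports.

Local Open Scope classical_set_scope.
Local Open Scope ring_scope.

(* A sub-sigma-algebra is a set of sets, so that several of them can live on
   the same measurable space. *)
Definition sub_sigma_algebra (d : measure_display) (T : measurableType d)
    (F : set_system T) : Prop :=
  sigma_algebra [set: T] F /\ F `<=` measurable.

Definition filtration (d : measure_display) (T : measurableType d)
    (G : nat -> set_system T) : Prop :=
  (forall n, sub_sigma_algebra (G n)) /\
  (forall m n, (m <= n)%N -> G m `<=` G n).

Definition filtration_limit (d : measure_display) (T : measurableType d)
    (G : nat -> set_system T) : set_system T :=
  <<s \bigcup_k G k >>.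

Definition measurable_wrt (d : measure_display) (T : measurableType d)
    (R : realType) (F : set_system T) (f : T -> R) : Prop :=
  forall B : set R, measurable B -> F (f @^-1` B).

(* [Z] is a (finite-valued) version of the conditional expectation E[X | F];
   versions are unique up to P-null sets. *)
Definition is_cond_expectation (d : measure_display) (T : measurableType d)
    (R : realType) (P : probability T R) (F : set_system T)
    (X Z : T -> R) : Prop :=
  [/\ measurable_wrt F Z,
      P.-integrable [set: T] (fun w => (Z w)%:E) &
      forall A : set T, F A ->
        (\int[P]_(w in A) (Z w)%:E = \int[P]_(w in A) (X w)%:E)%E].

Definition cvg_in_probability (d : measure_display) (T : measurableType d)
    (R : realType) (P : probability T R) (X_ : nat -> T -> R) (X : T -> R)
    : Prop :=
  forall eps : R, 0 < eps ->
    (fun n => P [set w | eps < `|X_ n w - X w|]) @ \oo --> 0%E.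

(* Main.v *)
Require Import Defs.
From HB Require Import structures.
From mathcomp Require Import all_boot all_order all_algebra.
From mathcomp Require Import all_classical all_reals all_analysis.
From mathcomp Require Import measurable_realfun ring lra.

(* Put [U_n = exp(- Y_n)] and [U = exp(- Y)]. Then
   E[(U_n - U)^2] = E[U_n^2 - U^2] - 2 E[(U_n - U) U].
   The first term tends to 0 by the hypothesis at [lambda = 2] and dominated
   convergence. At [lambda = 1], the same argument on an event of some [G_m],
   which lies in [G_n] for all [n >= m], gives E[(U_n - U) 1_A] -> 0. By the
   pi-lambda theorem this extends to [A] in the limit sigma-algebra, and then,
   by uniform approximation with step functions, to E[(U_n - U) U] -> 0. Hence
   [U_n -> U] in L^2, and Markov's inequality, applied on
   [Y <= K] with [P(Y > K)] small, gives [Y_n -> Y] in probability. *)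

Set Implicit Arguments.
Unset Strict Implicit.
Unset Printing Implicit Defensive.

Import Order.TTheory GRing.Theory Num.Theory.
Import numFieldNormedType.Exports.

Local Open Scope classical_set_scope.
Local Open Scope ring_scope.

(** * Integrals of bounded functions over a probability space *)

Section bounded_integrands.
Context (d : measure_display) (T : measurableType d) (R : realType)
  (P : probability T R).
Implicit Types (A : set T) (f g : T -> R).

Lemma bounded_integrable A f (M : R) : measurable A ->
  measurable_fun [set: T] f -> (forall w, `|f w| <= M) ->
  P.-integrable A (EFin \o f).
Proof.
move=> mA mf fM; apply: measurable_bounded_integrable => //.
- by rewrite ltey_eq fin_num_measure.
- exact: measurable_funTS.
- exists M; split; first exact: num_real.
  by move=> x Mx w _; exact: le_trans (fM w) (ltW Mx).
Qed.

Lemma normr_Rintegral_le_measure A f : measurable A ->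
  measurable_fun [set: T] f -> (forall w, `|f w| <= 1) ->
  `|\int[P]_(w in A) f w| <= fine (P A).
Proof.
move=> mA mf f1; apply: le_trans (le_normr_Rintegral mA _) _.
  exact: bounded_integrable f1.
rewrite -[leRHS]mul1r -Rintegral_cst//; apply: le_Rintegral => //.
- apply: (@bounded_integrable _ _ 1) => //; first exact: measurableT_comp.
  by move=> w; rewrite normr_id.
- by apply: (@bounded_integrable _ _ 1) => // w; rewrite normr1.
Qed.

(** Since [f] is positive on [A], its integral there is that of [|f|], hence zero. So [f] vanishes
    a.e. on [A], and [A] lies inside the exceptional null set. *)
Lemma measure0_of_integral_le0 A f : measurable A ->
  P.-integrable A (EFin \o f) -> (forall w, A w -> 0 < f w) ->
  (\int[P]_(w in A) (f w)%:E <= 0)%E -> P A = 0%E.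
Proof.
move=> mA intf f0 If0.
have mf := measurable_int _ intf.
have : (\int[P]_(w in A) `|(f w)%:E| = 0)%E.
  apply/eqP; rewrite eq_le integral_ge0// andbT.
  rewrite (eq_integral (EFin \o f))// => w /set_mem/f0 fw0 /=.
  by rewrite ger0_norm// ltW.
move/(ae_eq_integral_abs P mA mf) => [N [mN N0 AN]].
apply: subset_measure0 mA mN _ N0 => w Aw; apply: AN => /= /(_ Aw) [] fw0.
by have := f0 _ Aw; rewrite fw0 ltxx.
Qed.

End bounded_integrands.

(** * Bounds and limits for conditional expectations *)

(** The events [Z < 0] and [Z > 1] belong to [F], so on each of them [Z] may be replaced by [X]
    under the integral, which forces both to be null. This supplies the dominating constant for
    arbitrary versions [Z]. *)
Lemma cond_expectation_ae_ge0_le1 (d : measure_display) (T : measurableType d)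
    (R : realType) (P : probability T R) (F : set_system T) (X Z : T -> R) :
  F `<=` measurable -> measurable_fun [set: T] X ->
  (forall w, 0 <= X w <= 1) -> is_cond_expectation P F X Z ->
  {ae P, forall w, 0 <= Z w <= 1}.
Proof.
move=> Fm mX X01 [FZ intZ IZ].
have mZ : measurable_fun [set: T] Z.
  by move=> _ B mB; rewrite setTI; exact/Fm/FZ.
have intX A : measurable A -> P.-integrable A (EFin \o X).
  move=> mA; apply: (@bounded_integrable _ _ _ P _ _ 1) => // w.
  by have /andP[X0 X1] := X01 w; rewrite ger0_norm.
have FA (B : set R) : measurable B -> F (Z @^-1` B) by exact: FZ.
have intZA A : measurable A -> P.-integrable A (EFin \o Z).
  by move=> mA; apply: integrableS intZ.
pose A0 := Z @^-1` `]-oo, 0[; pose A1 := Z @^-1` `]1, +oo[.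
have FA0 : F A0 by exact: FA.
have FA1 : F A1 by exact: FA.
have mA0 := Fm _ FA0; have mA1 := Fm _ FA1.
have int1 : P.-integrable A1 (EFin \o cst 1).
  exact: finite_measure_integrable_cst.
have P0 : P A0 = 0%E.
  apply: (@measure0_of_integral_le0 _ _ _ P _ (fun w => - Z w)) => //.
  - exact: integrableN (intZA _ mA0).
  - by move=> w; rewrite /A0 /= in_itv /= oppr_gt0.
  - under eq_integral do rewrite EFinN.
    rewrite integralN; last exact: (integrable_add_def mA0 (intZA _ mA0)).
    rewrite IZ// leeNl oppe0 integral_ge0// => w _.
    by rewrite lee_fin; case/andP: (X01 w).
have P1 : P A1 = 0%E.
  apply: (@measure0_of_integral_le0 _ _ _ P _ (fun w => Z w - 1)) => //.
  - exact: (integrableB mA1 (intZA _ mA1) int1).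
  - by move=> w; rewrite /A1 /= in_itv /= andbT subr_gt0.
  - rewrite (integralB_EFin mA1 (intZA _ mA1) int1).
    rewrite IZ// sube_le0; apply: (le_integral mA1 (intX _ mA1) int1).
    by move=> w _; rewrite lee_fin; case/andP: (X01 w).
exists (A0 `|` A1); split.
- exact: measurableU.
- exact: null_set_setU.
- move=> w /= /negP; rewrite negb_and -!ltNge => /orP[Zw|Zw].
    by left; rewrite /A0 /= in_itv.
  by right; rewrite /A1 /= in_itv /= Zw.
Qed.

(** Once [A] belongs to [G n], the integrals of [X n] and [Z n] over [A] agree, and the latter
    converge to that of [u] by dominated convergence. *)
Lemma cvg_integral_sub_cond_expectation (d : measure_display)
    (T : measurableType d) (R : realType) (P : probability T R)
    (G : nat -> set_system T) (X Z : nat -> T -> R) (u : T -> R) (A : set T) :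
  (forall n, G n `<=` measurable) -> (\forall n \near \oo, G n A) ->
  (forall n, measurable_fun [set: T] (X n)) -> measurable_fun [set: T] u ->
  (forall n w, 0 <= X n w <= 1) -> (forall w, 0 <= u w <= 1) ->
  (forall n, is_cond_expectation P (G n) (X n) (Z n)) ->
  {ae P, forall w, Z n w @[n --> \oo] --> u w} ->
  \int[P]_(w in A) (X n w - u w) @[n --> \oo] --> 0.
Proof.
move=> Gm GA mX mu X01 u01 ceZ Zu.
have mA : measurable A.
  by case: GA => N _ /(_ N (leqnn N)); exact: Gm.
have int01 (f : T -> R) :
    measurable_fun [set: T] f -> (forall w, 0 <= f w <= 1) ->
    P.-integrable A (EFin \o f).
  move=> mf f01; apply: (@bounded_integrable _ _ _ P _ _ 1) => // w.
  by have /andP[f0 f1] := f01 w; rewrite ger0_norm.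
have mZ n : measurable_fun [set: T] (Z n).
  by case: (ceZ n) => GZ _ _ _ B mB; rewrite setTI; exact/Gm/GZ.
(* A countable union of null sets is null, so one exceptional set serves all [n]. *)
have Z01 : {ae P, forall w n, A w -> (`|(Z n w)%:E| <= (cst 1 w)%:E)%E}.
  have /ae_foralln := fun n => cond_expectation_ae_ge0_le1 (Gm n) (mX n)
    (X01 n) (ceZ n).
  apply: filterS => w Zw n _.
  by have /andP[Z0 Z1] := Zw n; rewrite lee_fin ger0_norm.
have [_ _ IZu] : [/\ P.-integrable A (EFin \o u),
    \int[P]_(w in A) `|(Z n w)%:E - (u w)%:E| @[n --> \oo] --> 0 &
    \int[P]_(w in A) (Z n w)%:E @[n --> \oo] --> \int[P]_(w in A) (u w)%:E]%E.
  apply: (@dominated_convergence _ _ _ P _ mA (fun n w => (Z n w)%:E)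
    (EFin \o u) (EFin \o cst 1)) => //.
  - by move=> n; apply/measurable_EFinP; exact: measurable_funTS.
  - by apply/measurable_EFinP; exact: measurable_funTS.
  - apply: filterS Zu => w Zuw _; by apply: cvg_EFin; [exact: nearW|exact: Zuw].
  - exact: (finite_measure_integrable_cst P 1 mA).
have IXu : \int[P]_(w in A) X n w @[n --> \oo] --> \int[P]_(w in A) u w.
  move: IZu; rewrite -(fineK (integrable_fin_num mA (int01 _ mu u01))).
  move/fine_cvg; apply: cvg_trans; apply: near_eq_cvg.
  apply: filterS GA => n GnA.
  by case: (ceZ n) => _ _ IZ; rewrite /Rintegral /= IZ.
rewrite -[X in _ --> X](subrr (\int[P]_(w in A) u w)).
under eq_cvg do
  rewrite (RintegralB mA (int01 _ (mX _) (X01 _)) (int01 _ mu u01)).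
by apply: cvgB => //; exact: cvg_cst.
Qed.

(** * From a pi-system to the sigma-algebra that it generates *)

Section asymptotically_null.
Context (d : measure_display) (T : measurableType d) (R : realType)
  (P : probability T R) (D : nat -> T -> R).
Hypotheses (mD : forall n, measurable_fun [set: T] (D n))
  (D1 : forall n w, `|D n w| <= 1).

Let intD n A : measurable A -> P.-integrable A (EFin \o D n).
Proof. by move=> mA; exact: bounded_integrable (D1 n). Qed.

Let splitD n A B : measurable A -> measurable B -> B `<=` A ->
  \int[P]_(w in A) D n w =
  \int[P]_(w in B) D n w + \int[P]_(w in A `\` B) D n w.
Proof.
move=> mA mB BA; have mAB := measurableD mA mB.
rewrite -Rintegral_setU//; first by rewrite setDUK.
- by rewrite setDUK//; exact: intD.
- by apply/disj_setPS => w [Bw []].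
Qed.

(** Proper differences follow from additivity. For increasing unions, [|D n| <= 1] bounds the
    integral over the part of the union outside [F k] by its probability, uniformly in [n], so [k]
    can be fixed before [n] tends to infinity. *)
Lemma lambda_system_cvg_integral0 :
  \int[P]_w D n w @[n --> \oo] --> 0 ->
  lambda_system [set: T]
    [set A | measurable A /\ \int[P]_(w in A) D n w @[n --> \oo] --> 0].
Proof.
move=> DT; split => //.
- move=> A B BA [mA DA] [mB DB]; split; first exact: measurableD.
  rewrite -[X in _ --> X](subrr 0); apply: cvg_trans (cvgB DA DB).
  apply: near_eq_cvg; apply: nearW => n; rewrite !fctE.
  rewrite (splitD n mA mB BA).
  by rewrite addrAC subrr add0r.
- move=> F ndF DF.
  have mF i : measurable (F i) by case: (DF i).
  have mU : measurable (\bigcup_i F i) by exact: bigcupT_measurable.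
  split => //; apply/cvgrPdist_le => e e0.
  have e20 : 0 < e / 2 by rewrite divr_gt0.
  (* Continuity from below makes the remainder small. *)
  have [k PFk] : exists k, fine (P (\bigcup_i F i `\` F k)) <= e / 2.
    have : P (F i) @[i --> \oo] --> P (\bigcup_i F i).
      exact: nondecreasing_cvg_mu.
    rewrite -(fineK (fin_num_measure P _ mU)).
    move=> /fine_cvg/cvgrPdist_le/(_ _ e20)[k _ /(_ k (leqnn k))] /= Fk.
    exists k; rewrite measureD// ?ltey_eq ?fin_num_measure//.
    rewrite setIidr; last exact: bigcup_sup.
    rewrite fineB ?fin_num_measure//.
    exact: le_trans (ler_norm _) Fk.
  have /cvgrPdist_le/(_ _ e20) := (DF k).2.
  apply: filterS => n; rewrite !sub0r !normrN => Dk.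
  rewrite (splitD _ mU (mF k)); last exact: bigcup_sup.
  apply: le_trans (ler_normD _ _) _; rewrite [leRHS]splitr lerD//.
  apply: le_trans PFk; apply: normr_Rintegral_le_measure => //.
  exact: measurableD.
Qed.

End asymptotically_null.

Lemma cvg_integral0_g_sigma_algebra (d : measure_display)
    (T : measurableType d) (R : realType) (P : probability T R)
    (D : nat -> T -> R) (C : set_system T) :
  (forall n, measurable_fun [set: T] (D n)) -> (forall n w, `|D n w| <= 1) ->
  setI_closed C -> C [set: T] -> C `<=` measurable ->
  (forall A, C A -> \int[P]_(w in A) D n w @[n --> \oo] --> 0) ->
  forall A, <<s C >> A -> \int[P]_(w in A) D n w @[n --> \oo] --> 0.
Proof.
move=> mD D1 CI CT Cm DC A sCA.
have lH := lambda_system_cvg_integral0 mD D1 (DC _ CT).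
apply: (lambda_system_subset CI lH _ _ sCA).2 => // B CB.
by split; [exact: Cm|exact: DC].
Qed.

(** Two events of the union lie in a common [G (maxn m n)]. This makes the union a pi-system. *)
Lemma setI_closed_bigcup_filtration (d : measure_display)
    (T : measurableType d) (G : nat -> set_system T) :
  filtration G -> setI_closed (\bigcup_n G n).
Proof.
move=> [sG ndG] A B [m _ GA] [n _ GB]; exists (maxn m n) => //.
have [_ _ _] := (sigma_algebraP (fun X _ => @subsetT _ X)).1
  (sG (maxn m n)).1.
by apply; [exact: ndG (leq_maxl m n) _ GA|exact: ndG (leq_maxr m n) _ GB].
Qed.

(** * Uniform approximation by step functions *)

(* The sum is the integer part of [x], truncated at [k]. *)
Lemma normr_sub_sum_threshold_le1 (R : realDomainType) (k : nat) (x : R) :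
  0 <= x <= k%:R -> `|x - \sum_(j < k) (j.+1%:R <= x)%R%:R| <= 1.
Proof.
move=> /andP[x0 xk].
pose s k : R := \sum_(j < k) (j.+1%:R <= x)%R%:R.
(* Induction on the truncation level needs three facts: the sum is saturated below [x], never
   exceeds [x], and is within 1 of [x] as soon as the level reaches [x]. *)
have sub1 : forall k, (k%:R <= x -> s k = k%:R) /\ (s k <= x) /\
    (x <= k%:R -> x - 1 <= s k).
  elim=> [|m [sm [smx xm]]].
    rewrite /s big_ord0; split => //; split => // {}x0'.
    by rewrite (le_trans _ x0')// gerBl.
  have -> : s m.+1 = s m + (m.+1%:R <= x)%R%:R by rewrite /s big_ord_recr.
  have [mx|xm1] := leP m.+1%:R x.
    have smE : s m = m%:R.
      by apply: sm; apply: le_trans mx; rewrite ler_nat.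
    rewrite smE natr1; split => //; split => // xm1.
    by apply: le_trans xm1; rewrite gerBl.
  rewrite addr0; split => //; split => // _.
  have [xm'|mx] := leP x m%:R; first exact: xm.
  by rewrite sm ?(ltW mx)// lerBlDr natr1 ltW.
have [_ [sx xs]] := sub1 k; rewrite -/(s k).
by rewrite ger0_norm ?subr_ge0// lerBlDr addrC -lerBlDr xs.
Qed.

Lemma normr_sum_indic_le (T : Type) (R : realDomainType) (A : nat -> set T)
    (k : nat) (w : T) : `|\sum_(j < k) \1_(A j) w| <= k%:R :> R.
Proof.
rewrite (le_trans (ler_norm_sum _ _ _))//.
rewrite -[k in leRHS]card_ord -sumr_const ler_sum// => j _.
by rewrite ger0_norm ?indicE// lern1 leq_b1.
Qed.

Section product_test.
Context (d : measure_display) (T : measurableType d) (R : realType)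
  (P : probability T R) (D : nat -> T -> R) (F : set_system T).
Hypotheses (mD : forall n, measurable_fun [set: T] (D n))
  (D1 : forall n w, `|D n w| <= 1) (Fm : F `<=` measurable)
  (DF : forall A, F A -> \int[P]_(w in A) D n w @[n --> \oo] --> 0).

Let int_mul n (g : T -> R) (M : R) : measurable_fun [set: T] g ->
  (forall w, `|g w| <= M) -> P.-integrable [set: T] (EFin \o (D n \* g)).
Proof.
move=> mg gM; apply: (@bounded_integrable _ _ _ P _ _ M) => //.
  exact: measurable_funM.
by move=> w; rewrite normrM -[leRHS]mul1r ler_pM.
Qed.

Lemma cvg_integral_mul_sum_indic0 (A : nat -> set T) (k : nat) :
  (forall j, F (A j)) ->
  \int[P]_w (D n w * \sum_(j < k) \1_(A j) w) @[n --> \oo] --> 0.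
Proof.
move=> FA.
have msum m : measurable_fun [set: T] (fun w => \sum_(j < m) \1_(A j) w : R).
  by apply: measurable_sum => j; apply: measurable_indic; exact/Fm/FA.
elim: k => [|k IH].
  apply: cvg_near_cst; apply: nearW => n.
  under eq_Rintegral do rewrite big_ord0 mulr0.
  by rewrite Rintegral_cst// mul0r.
rewrite -[X in _ --> X](addr0 0).
apply: cvg_trans (cvgD IH (DF (FA k))); apply: near_eq_cvg; apply: nearW => n.
rewrite !fctE.
under [RHS]eq_Rintegral do rewrite big_ord_recr/= mulrDr.
rewrite RintegralD//; last 2 first.
- exact: int_mul (msum k) (@normr_sum_indic_le _ _ A k).
- apply: (@int_mul _ _ 1); first by apply: measurable_indic; exact/Fm/FA.
  by move=> w; rewrite ger0_norm ?indicE// lern1 leq_b1.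
(* Multiplying by the indicator of [A k] amounts to integrating over [A k]. *)
by congr (_ + _); rewrite Rintegral_mkcond patch_indic.
Qed.

(** A step function built from level sets of [v] is within [1/K] of [v]. Its integral against [D n]
    tends to 0 for fixed [K], and the error contributes at most [1/K] for every [n]. *)
Lemma cvg_integral_mul0 (v : T -> R) : measurable_wrt F v ->
  (forall w, 0 <= v w <= 1) -> \int[P]_w (D n w * v w) @[n --> \oo] --> 0.
Proof.
move=> Fv v01; apply/cvgrPdist_le => e e0.
have e20 : 0 < e / 2 by rewrite divr_gt0.
have [k ke] : exists k : nat, k.+1%:R^-1 <= e / 2.
  have [k _ /(_ k (leqnn k)) /= ke] := near_infty_natSinv_lt (PosNum e20).
  by exists k; exact: ltW.
pose K : R := k.+1%:R.
have K0 : 0 < K by rewrite ltr0n.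
(* With [K = k + 1], the thresholds [1/K, ..., K/K] for [j < k.+1] subdivide the unit interval. The
   indicators of the [A j] then sum to the integer part of [K * v]. *)
pose A j := v @^-1` `[j.+1%:R / K, +oo[.
have FA j : F (A j) by exact: Fv.
have AE j w : \1_(A j) w = (j.+1%:R <= K * v w)%R%:R :> R.
  rewrite indicE; congr (_ %:R); congr nat_of_bool.
  apply/idP/idP => [/set_mem|H].
    by rewrite /A /= in_itv /= andbT ler_pdivrMr// mulrC.
  by apply/mem_set; rewrite /A /= in_itv /= andbT ler_pdivrMr// mulrC.
have mv : measurable_fun [set: T] v.
  by move=> _ B mB; rewrite setTI; exact/Fm/Fv.
have msum : measurable_fun [set: T] (fun w => \sum_(j < k.+1) \1_(A j) w : R).
  by apply: measurable_sum => j; apply: measurable_indic; exact/Fm.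
have v1 w : `|v w| <= 1 by have /andP[v0 ?] := v01 w; rewrite ger0_norm.
pose r w := v w - K^-1 * \sum_(j < k.+1) \1_(A j) w.
have mr : measurable_fun [set: T] r.
  by apply: measurable_funB => //; exact: measurable_funM.
have rK w : `|r w| <= K^-1.
  have -> : r w = K^-1 * (K * v w - \sum_(j < k.+1) (j.+1%:R <= K * v w)%R%:R).
    rewrite mulrBr mulKf ?gt_eqF//; congr (_ - _ * _).
    by apply: eq_bigr => j _; exact: AE.
  rewrite normrM gtr0_norm ?invr_gt0// -[leRHS]mulr1 ler_pM2l ?invr_gt0//.
  apply: normr_sub_sum_threshold_le1; have /andP[v0 v1'] := v01 w.
  by rewrite mulr_ge0 ?(ltW K0)//= ler_piMr// ltW.
have /cvgrPdist_le/(_ _ e20) : K^-1 * \int[P]_w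
    (D n w * \sum_(j < k.+1) \1_(A j) w) @[n --> \oo] --> 0.
  rewrite -[X in _ --> X](mulr0 K^-1); apply: cvgM; first exact: cvg_cst.
  exact: cvg_integral_mul_sum_indic0.
apply: filterS => n; rewrite !sub0r !normrN => Dn.
have -> : \int[P]_w (D n w * v w) =
    \int[P]_w (D n w * r w) +
    K^-1 * \int[P]_w (D n w * \sum_(j < k.+1) \1_(A j) w).
  have intS : P.-integrable [set: T]
      (EFin \o (D n \* (fun w => \sum_(j < k.+1) \1_(A j) w))).
    exact: int_mul msum (@normr_sum_indic_le _ _ A k.+1).
  have intr := int_mul n mr rK.
  rewrite -RintegralZl// -RintegralD//; last first.
    have := integrableZl measurableT K^-1 intS.
    by apply: eq_integrable => // w _; rewrite /= EFinM.
  by apply: eq_Rintegral => w _; rewrite /r; ring.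
rewrite [leRHS]splitr (le_trans (ler_normD _ _))// lerD// (le_trans _ ke)//.
apply: le_trans (le_normr_Rintegral measurableT (int_mul n mr rK)) _.
(* Writing 1 as the total mass turns [K^-1] into the integral of a constant. *)
rewrite -[leRHS]mulr1 -[X in _ * X]/(fine 1%E) -(@probability_setT _ _ _ P).
rewrite -Rintegral_cst//; apply: le_Rintegral => //.
- by apply: integrable_norm => //; exact: int_mul mr rK.
- exact: finite_measure_integrable_cst.
- by move=> w _; rewrite normrM -[leRHS]mul1r ler_pM.
Qed.

End product_test.

(** * From mean-square convergence of the exponentials to convergence in probability *)

(** The smaller of [a] and [b] is at most [K] because [b] is. For [x <= K] and [y >= x + e],
    factoring [expR (- x)] out of the difference gives the bound. *)
Lemma expRN_dist_ge (R : realType) (a b K e : R) :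
  b <= K -> 0 <= e -> e < `|a - b| ->
  expR (- K) * (1 - expR (- e)) <= `|expR (- a) - expR (- b)|.
Proof.
move=> bK e0 eab.
have key (x y : R) : x <= K -> x + e <= y ->
    expR (- K) * (1 - expR (- e)) <= expR (- x) - expR (- y).
  move=> xK xey; apply: (@le_trans _ _ (expR (- x) * (1 - expR (- e)))).
    rewrite ler_wpM2r ?ler_expR ?lerN2//.
    by rewrite subr_ge0 -[leRHS]expR0 ler_expR oppr_le0.
  by rewrite mulrBr mulr1 -expRD lerD2l lerN2 ler_expR -opprD lerN2.
have [ab|ba] := leP a b.
  apply: le_trans (key a b (le_trans ab bK) _) (ler_norm _).
  by move: eab; rewrite ler0_norm ?subr_le0// => ?; lra.
rewrite distrC; apply: le_trans (key b a bK _) (ler_norm _).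
by move: eab; rewrite gtr0_norm ?subr_gt0// => ?; lra.
Qed.

Lemma cvg_in_probability_of_expRN (d : measure_display) (T : measurableType d)
    (R : realType) (P : probability T R) (Y : {RV P >-> R})
    (Y_ : nat -> {RV P >-> R}) :
  (forall w, 0 <= Y w) -> (forall n w, 0 <= Y_ n w) ->
  \int[P]_w ((expR (- Y_ n w) - expR (- Y w)) ^+ 2) @[n --> \oo] --> 0 ->
  cvg_in_probability P (fun n => Y_ n) Y.
Proof.
move=> Y0 Yn0 L2 e e0.
pose D n w := (expR (- Y_ n w) - expR (- Y w)) ^+ 2.
have mD n : measurable_fun [set: T] (D n).
  apply: measurable_funX; apply: measurable_funB.
    by apply: measurableT_comp => //; exact: measurableT_comp.
  by apply: measurableT_comp => //; exact: measurableT_comp.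
have D0 n w : 0 <= D n w by exact: sqr_ge0.
have D1 n w : D n w <= 1.
  rewrite /D -(expr1n R 2) -(real_normK (num_real (_ - _))).
  rewrite ler_sqr ?nnegrE// ler_norml.
  have := expR_gt0 (- Y_ n w); have := expR_gt0 (- Y w).
  have : expR (- Y_ n w) <= 1 by rewrite -[leRHS]expR0 ler_expR oppr_le0.
  have : expR (- Y w) <= 1 by rewrite -[leRHS]expR0 ler_expR oppr_le0.
  by move=> *; apply/andP; split; lra.
have intD n : P.-integrable [set: T] (EFin \o D n).
  apply: (@bounded_integrable _ _ _ P _ _ 1) => // w.
  by rewrite ger0_norm.
have mE n : measurable [set w | e < `|Y_ n w - Y w|].
  have mdist : measurable_fun [set: T] (fun w => `|Y_ n w - Y w|).
    by apply: measurableT_comp => //; exact: measurable_funB.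
  have := mdist measurableT _ (measurable_itv `]e, +oo[).
  rewrite setTI; congr measurable; apply/seteqP.
  by split => w /=; rewrite in_itv /= andbT.
apply/fine_cvgP; split; first by apply: nearW => n; rewrite fin_num_measure.
apply/cvgrPdist_le => t t0.
have t20 : 0 < t / 2 by rewrite divr_gt0.
(* [ccdf Y K] is the probability of [Y > K], which tends to 0. The limit at infinity holds strictly
   beyond a bound, whence the shift by 1. *)
have [K PK] : exists K, fine (ccdf Y K) <= t / 2.
  have /fine_cvg/cvgrPdist_le/(_ _ t20)[K [_ HK]] := cvg_ccdfy0 Y.
  exists (K + 1); have := HK (K + 1); rewrite ltrDl => /(_ ltr01) /=.
  by rewrite sub0r normrN; apply: le_trans; exact: ler_norm.
(* The lower bound of [expRN_dist_ge]: on [Y <= K], a deviation larger than [e] forces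
   [D n >= c ^+ 2]. *)
pose c := expR (- K) * (1 - expR (- e)).
have c0 : 0 < c.
  by rewrite mulr_gt0 ?expR_gt0// subr_gt0 -[ltRHS]expR0 ltr_expR oppr_lt0.
have tc0 : 0 < t / 2 * c ^+ 2 by rewrite mulr_gt0// exprn_gt0.
have /cvgrPdist_le/(_ _ tc0) := L2.
apply: filterS => n; rewrite !sub0r !normrN /= => In.
have mB : measurable [set w | c ^+ 2 <= D n w].
  by rewrite -[X in measurable X]setTI; exact: measurable_fun_le.
(* Markov's inequality, by comparing [D n] with [c ^+ 2] times the indicator of the event. *)
have markovD : c ^+ 2 * fine (P [set w | c ^+ 2 <= D n w]) <= \int[P]_w D n w.
  rewrite -Rintegral_cst// Rintegral_mkcond; apply: le_Rintegral => //.
  - have := finite_measure_integrable_cst P (c ^+ 2) mB.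
    by move/(integrable_mkcond _ mB); rewrite restrict_EFin.
  - by move=> w _; rewrite patchE; case: ifPn => [/set_mem//|_]; exact: D0.
rewrite ger0_norm ?fine_ge0//.
have sub : [set w | e < `|Y_ n w - Y w|] `<=`
    (Y @^-1` `]K, +oo[) `|` [set w | c ^+ 2 <= D n w].
  move=> w /= ew; have [YK|KY] := leP (Y w) K;
    last by left; rewrite in_itv /= KY.
  right; rewrite /D -(real_normK (num_real (_ - _))).
  rewrite ler_sqr ?nnegrE ?(ltW c0)//; exact: expRN_dist_ge (ltW e0) ew.
have mK : measurable (Y @^-1` `]K, +oo[).
  by rewrite -[X in measurable X]setTI; exact: measurable_funP.
apply: (@le_trans _ _ (fine (P (Y @^-1` `]K, +oo[)) +
    fine (P [set w | c ^+ 2 <= D n w]))).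
  rewrite -fineD ?fin_num_measure// fine_le ?fin_numD ?fin_num_measure//.
  apply: le_trans (measureU2 _ mK mB).
  by apply: le_measure => //; rewrite inE//; exact: measurableU.
rewrite [leRHS]splitr lerD//.
rewrite -(@ler_pM2l _ (c ^+ 2)) ?exprn_gt0// (le_trans markovD)//.
by rewrite mulrC (le_trans _ In)// ler_norm.
Qed.

(** * Mean-square convergence of the exponentials under the hypotheses on conditional Laplace
    transforms *)

Theorem lemmaB1 (d : measure_display) (T : measurableType d) (R : realType)
    (P : probability T R) (G : nat -> set_system T)
    (Y : {RV P >-> R}) (Y_ : nat -> {RV P >-> R})
    (Z : rat -> nat -> T -> R)
    (hG : filtration G)
    (Y_ge0 : forall w, 0 <= Y w)
    (Yn_ge0 : forall n w, 0 <= Y_ n w)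
    (mY : measurable_wrt (filtration_limit G) Y)
    (hZ : forall lambda : rat, 0 < lambda -> forall n,
      is_cond_expectation P (G n) (fun w => expR (- ratr lambda * Y_ n w))
        (Z lambda n))
    (Z_cvg : forall lambda : rat, 0 < lambda ->
      {ae P, forall w,
        (fun n => Z lambda n w) @ \oo --> expR (- ratr lambda * Y w)}) :
  cvg_in_probability P (fun n => Y_ n) Y.
Proof.
have [sG ndG] := hG.
have Gm n : G n `<=` measurable by case: (sG n).
have GT n : G n [set: T].
  by case: (sG n) => -[G0 GD _] _; rewrite -[setT]setD0; exact: GD.
have CT : (\bigcup_n G n) [set: T] by exists 0%N.
have Cm : \bigcup_n G n `<=` measurable by move=> A [n _]; exact: Gm.
have Fm : filtration_limit G `<=` measurable.
  by apply: smallest_sub => //; exact: sigma_algebra_measurable.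
have mexp (l : R) (f : {RV P >-> R}) :
    measurable_fun [set: T] (fun w => expR (- l * f w)).
  by apply: measurableT_comp => //; exact: measurable_funM.
have exp01 (l : R) (x : R) : 0 <= l -> 0 <= x -> 0 <= expR (- l * x) <= 1.
  move=> l0 x0; rewrite expR_ge0 -[leRHS]expR0 ler_expR mulNr oppr_le0.
  exact: mulr_ge0.
(* An event of [G m] stays in every later [G n], so it can be tested against almost all the
   conditional expectations. *)
have DG (l : rat) : 0 < l -> forall A, (\bigcup_n G n) A -> \int[P]_(w in A)
    (expR (- ratr l * Y_ n w) - expR (- ratr l * Y w)) @[n --> \oo] --> 0.
  move=> l0 A [m _ GA]; have l0' : 0 <= ratr l :> R by rewrite ler0q ltW.
  apply: (cvg_integral_sub_cond_expectation Gm _ _ _ _ _ (hZ _ l0)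
    (Z_cvg _ l0)).
  - by exists m => // n mn; exact: ndG mn _ GA.
  - by move=> n; exact: mexp.
  - exact: mexp.
  - by move=> n w; exact: exp01.
  - by move=> w; exact: exp01.
pose D n w := expR (- Y_ n w) - expR (- Y w).
have mexp1 (f : {RV P >-> R}) : measurable_fun [set: T] (fun w => expR (- f w)).
  by apply: measurableT_comp => //; exact: measurableT_comp.
have mD n : measurable_fun [set: T] (D n) by exact: measurable_funB.
have exp01' (x : R) : 0 <= x -> 0 <= expR (- x) <= 1.
  by move=> x0; rewrite -mulN1r exp01.
have D1 n w : `|D n w| <= 1.
  have /andP[? ?] := exp01' _ (Y_ge0 w).
  have /andP[? ?] := exp01' _ (Yn_ge0 n w).
  by rewrite /D ler_norml; apply/andP; split; lra.
have Du : \int[P]_w (D n w * expR (- Y w)) @[n --> \oo] --> 0.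
  apply: (cvg_integral_mul0 mD D1 Fm) => //; last by move=> w; exact: exp01'.
    apply: cvg_integral0_g_sigma_algebra => //.
      exact: setI_closed_bigcup_filtration.
    move=> A GA; have := DG 1 ltr01 A GA; rewrite rmorph1.
    by under eq_fun do under eq_Rintegral do rewrite !mulN1r.
  move=> B mB.
  (* [expR (- Y)] inherits measurability for the limit sigma-algebra, being a Borel function of
     [Y]. *)
  rewrite (_ : _ @^-1` B = Y @^-1` ((fun y => expR (- y)) @^-1` B))//.
  apply: mY; rewrite -[X in measurable X]setTI.
  have mE : measurable_fun [set: R] (fun y : R => expR (- y)).
    by apply: measurableT_comp => //; exact: oppr_measurable.
  exact: mE.
apply: cvg_in_probability_of_expRN => //.
have Du2 : 2 * \int[P]_w (D n w * expR (- Y w)) @[n --> \oo] --> 2 * (0 : R).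
  by apply: cvgM; [exact: cvg_cst|exact: Du].
(* The limit 0 is written [0 - 2 * 0] to match the expansion of [D n w ^+ 2] as
   [expR (- 2 * Y_ n w) - expR (- 2 * Y w)] minus [2 * (D n w * expR (- Y w))]. The first difference
   is the case [l = 2] of [DG] on the whole space. *)
rewrite -[X in _ --> X](subr0 0) -[X in _ --> 0 - X](mulr0 2).
apply: cvg_trans (cvgB (DG 2 isT _ CT) Du2).
apply: near_eq_cvg; apply: nearW => n; rewrite !fctE /D (ratr_nat R 2).
have intDu : P.-integrable [set: T] (EFin \o (fun w => D n w * expR (- Y w))).
  apply: (@bounded_integrable _ _ _ P _ _ 1) => //.
    exact: measurable_funM.
  move=> w; rewrite normrM -[leRHS]mul1r ler_pM//.
  by have /andP[? ?] := exp01' _ (Y_ge0 w); rewrite ger0_norm.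
have intD2 : P.-integrable [set: T] (EFin \o (fun w =>
    expR (- 2 * Y_ n w) - expR (- 2 * Y w))).
  apply: (@bounded_integrable _ _ _ P _ _ 1) => //.
    exact: measurable_funB.
  move=> w; have /andP[? ?] := exp01 2 _ (ler0n _ _) (Y_ge0 w).
  have /andP[? ?] := exp01 2 _ (ler0n _ _) (Yn_ge0 n w).
  by rewrite ler_norml; apply/andP; split; lra.
have intDu2 : P.-integrable [set: T]
    (EFin \o (fun w => 2 * (D n w * expR (- Y w)))).
  have := integrableZl measurableT 2 intDu.
  by apply: eq_integrable => // w _; rewrite /= EFinM.
rewrite -(RintegralZl 2 measurableT intDu).
rewrite -(RintegralB measurableT intD2 intDu2).
apply: eq_Rintegral => w _.
have expR2 (x : R) : expR (- 2 * x) = expR (- x) ^+ 2.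
  by rewrite -expRM_natl mulNr mulrN.
by rewrite !expR2 /D; ring.
Qed.
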